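(* Let $(x_n)_{n=1}^\infty\subseteq[0,1]$ be such that for every $h\in\mathbb{N}$ the sequence $(x_{n+h}-x_n)_{n=1}^\infty$ (differences taken modulo $1$) is uniformly distributed. Let $(n_k)_{k=1}^\infty$ be the increasing enumeration of those $n\in\mathbb{N}$ for which $w_n=1$, where $(w_n)_{n=1}^\infty$ is the Thue-Morse sequence. Then $(x_{n_k})_{k=1}^\infty$ is uniformly distributed.
   Context: $\mathbb{N}=\{1,2,3,\dots\}$. The Thue-Morse sequence $(w_n)_{n=1}^\infty\in\{-1,1\}^{\mathbb{N}}$ is given by $w_n=(-1)^{e_n}$, where $e_n$ is the number of times the digit $1$ appears in the base $2$ expansion of $n$. A sequence in $[0,1]$ is uniformly distributed if for every interval $I\subseteq[0,1]$ the proportion of the first $N$ terms lying in $I$ tends to the length of $I$ as $N\to\infty$. Differences of elements of $[0,1]$ are taken modulo $1$. *)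

(* Defs.v *)
From mathcomp Require Import all_boot all_order all_algebra.
From mathcomp Require Import all_classical all_reals all_analysis.
Set Implicit Arguments.
Unset Strict Implicit.
Unset Printing Implicit Defensive.
Import Order.TTheory GRing.Theory Num.Theory.
Import numFieldNormedType.Exports.
Local Open Scope classical_set_scope.
Local Open Scope ring_scope.

(* Sequences (a_n)_{n >= 1} are functions on [nat]; the value at 0 is never
   used. *)

(* The i-th binary digit of n is [odd (n %/ 2 ^ i)]. Since n < 2 ^ n, the
   digits of rank i >= n all vanish, so the sum counts every digit 1 of n. *)
Definition num_ones (n : nat) : nat := (\sum_(i < n) odd (n %/ 2 ^ i))%N.

Definition thue_morse (n : nat) : int := (-1) ^+ num_ones n.

Definition frac_part (R : realType) (y : R) : R := y - (Num.floor y)%:~R.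

(* The Booleans l and r choose whether the endpoints a and b belong to the
   interval, so that all open, closed and half-open intervals (degenerate ones
   included) contained in [0, 1] are covered. *)
Definition unif_distributed (R : realType) (u : nat -> R) : Prop :=
  forall (a b : R) (l r : bool), 0 <= a -> a <= b -> b <= 1 ->
    (\sum_(1 <= n < N.+1) (u n \in Interval (BSide l a) (BSide r b)))%N%:R / N%:R
      @[N --> \oo] --> b - a.

Definition increasing_enumeration (nk : nat -> nat) (P : nat -> Prop) : Prop :=
  (forall k l : nat, (0 < k)%N -> (k < l)%N -> (nk k < nk l)%N) /\
  (forall n : nat, ((0 < n)%N /\ P n) <-> (exists k : nat, (0 < k)%N /\ nk k = n)).

(* Main.v *)
Require Import Defs.
From mathcomp Require Import all_boot all_order all_algebra.
From mathcomp Require Import all_classical all_reals all_analysis.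
From mathcomp Require Import ring lra zify.
Import Order.TTheory GRing.Theory Num.Theory.
Import numFieldNormedType.Exports.
Local Open Scope classical_set_scope.
Local Open Scope ring_scope.
Set Implicit Arguments.
Unset Strict Implicit.
Unset Printing Implicit Defensive.

(** The hypothesis on differences says that (x_n) has no correlations, i.e. that
it has Lebesgue spectrum, while the Thue-Morse sequence w has singular
spectrum; two such sequences do not correlate. The proof below makes this
effective without any harmonic analysis.

Singularity of w is used in the form [shift_approximable_tm_sign]: in mean
square, w_n is approximated by -(3/K) times the sum of K of its shifts
w_(n + 2^(K i)), i < K. Indeed the correlation of w with its shift by a power
of 2 is -1/3, while the correlation of two of these shifts is close to
(-1/3)^2 = 1/9, so the shifts behave like independent variables of mean -1/3
relative to w and obey a law of large numbers. The constant sequence 1 has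
the same property in a trivial way.

If v is such a sequence and z is a vector valued sequence with asymptotically
small correlations, then in the mean of v_n z_n one may replace v by its
average of shifts and carry the shifts over to z; the average of K shifts of z
is small in mean square because these shifts are nearly orthogonal. This is
[van_der_corput_weighted], a van der Corput inequality with weights.

Instead of exponentials, the vectors z_n record in which windows x_n lies. The
circle is cut into Q cells, and the j-th coordinate of z_n is the centred
indicator that x_n lies in a window of q consecutive cells, translated by j.
The inner product of z_m and z_n depends, up to 2, only on the cell of
x_m - x_n modulo 1, and its mean over all cells vanishes: therefore the
correlations of z are at most 2 (see [upper_mean_feature_corr]), whatever
Q is. Consequently, with p_n = (1 + w_n) / 2, the squares of the Q sums of
p_n z_n over n < N have a total of at most about 41 N^2
([tm_feature_square_sum]).

An interval [a, b] is contained in r of the translates of a window that is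
longer by about r / Q only. If all these translates were too rich, by eps N,
the total would exceed r eps^2 N^2; so for r large some translate is not too
rich, and this bounds the frequency of [a, b] along the n with w_n = 1
([tm_interval_count]). The lower bound follows by taking complements. *)

(** * Upper bounds for means *)

(** This encodes limsup u N / N <= e. The additive constant A takes the place of
a threshold on N, so that such bounds can be combined without comparing
thresholds. *)
Definition upper_mean_le (R : realType) (u : nat -> R) (e : R) : Prop :=
  forall d : R, 0 < d ->
    exists A : R, forall N : nat, u N <= (e + d) * N%:R + A.

Lemma upper_mean_le_trans (R : realType) (u v : nat -> R) (e A : R) :
  (forall N, u N <= v N + A) -> upper_mean_le v e -> upper_mean_le u e.
Proof.
move=> uv vle d /vle [B HB]; exists (B + A) => N.
by have := uv N; have := HB N; lra.
Qed.

Lemma upper_mean_le_linear (R : realType) (u : nat -> R) (e A : R) :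
  (forall N, u N <= e * N%:R + A) -> upper_mean_le u e.
Proof.
move=> ue d d0; exists A => N.
have := ue N; have : 0 <= d * N%:R by rewrite mulr_ge0// ltW.
lra.
Qed.

Lemma upper_mean_leW (R : realType) (u : nat -> R) (e e' : R) :
  e <= e' -> upper_mean_le u e -> upper_mean_le u e'.
Proof.
move=> ee ue d /ue [A HA]; exists A => N.
have := HA N; have : 0 <= (e' - e) * N%:R by rewrite mulr_ge0// subr_ge0.
lra.
Qed.

Lemma upper_mean_leD (R : realType) (u v : nat -> R) (e f : R) :
  upper_mean_le u e -> upper_mean_le v f ->
  upper_mean_le (fun N => u N + v N) (e + f).
Proof.
move=> ue vf d d0.
have d20 : 0 < d / 2 by lra.
have [A HA] := ue _ d20; have [B HB] := vf _ d20.
exists (A + B) => N; have := HA N; have := HB N; nra.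
Qed.

Lemma upper_mean_leZ (R : realType) (u : nat -> R) (k e : R) :
  0 <= k -> upper_mean_le u e -> upper_mean_le (fun N => k * u N) (k * e).
Proof.
move=> k0 ue d d0.
have k1 : 0 < k + 1 by lra.
have [A HA] := ue _ (divr_gt0 d0 k1); exists (k * A) => N.
apply: (le_trans (ler_wpM2l k0 (HA N))).
have -> : k * ((e + d / (k + 1)) * N%:R + A) =
  (k * e + k * (d / (k + 1))) * N%:R + k * A by ring.
rewrite lerD2r ler_wpM2r// lerD2l mulrA ler_pdivrMr//; nra.
Qed.

Lemma upper_mean_le_sum (R : realType) (K : nat) (u : nat -> nat -> R)
    (e : nat -> R) :
  (forall i, (i < K)%N -> upper_mean_le (u i) (e i)) ->
  upper_mean_le (fun N => \sum_(i < K) u i N) (\sum_(i < K) e i).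
Proof.
elim: K => [|K IH] H.
  by rewrite big_ord0; apply: (@upper_mean_le_linear _ _ _ 0) => N; rewrite big_ord0; lra.
apply: (@upper_mean_le_trans _ _ (fun N => \sum_(i < K) u i N + u K N) _ 0).
  by move=> N; rewrite big_ord_recr/= addr0.
rewrite big_ord_recr/=; apply: upper_mean_leD; last exact: H.
by apply: IH => i iK; apply: H; rewrite ltnS ltnW.
Qed.

(** * A weighted van der Corput inequality *)

Lemma sum_shift_bound (R : realType) (g : nat -> R) (B : R) (s N : nat) :
  (forall n, `|g n| <= B) ->
  `|\sum_(n < N) g (n + s)%N - \sum_(n < N) g n| <= 2 * B * s%:R.
Proof.
move=> gB.
have step k : \sum_(n < N) g (n + k.+1)%N =
    \sum_(n < N) g (n + k)%N + g (N + k)%N - g k.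
  elim: N => [|M IH]; first by rewrite !big_ord0 add0n; ring.
  by rewrite !big_ord_recr/= IH addSn -addnS; ring.
elim: s => [|s IH].
  by under eq_bigr do rewrite addn0; rewrite subrr normr0 mulr0.
rewrite step -natr1.
set S1 := \sum_(n < N) g (n + s)%N in IH *.
set S0 := \sum_(n < N) g n in IH *.
have -> : S1 + g (N + s)%N - g s - S0 = (S1 - S0) + (g (N + s)%N - g s) by ring.
apply: (le_trans (ler_normD _ _)).
have := ler_normB (g (N + s)%N) (g s); have := gB (N + s)%N; have := gB s.
move: IH; lra.
Qed.

(** Cauchy-Schwarz, from the sum of the squares of N a_n - S b_n being
nonnegative, where S is the sum on the left. *)
Lemma sqr_sum_mul_le (R : realType) (N : nat) (a b : nat -> R) :
  (forall n, `|b n| <= 1) ->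
  (\sum_(n < N) a n * b n) ^+ 2 <= N%:R * \sum_(n < N) a n ^+ 2.
Proof.
move=> b1; case: N => [|N]; first by rewrite !big_ord0 expr0n/= mul0r.
set S := \sum_(n < _) _; set T := \sum_(n < _) _.
have N0 : 0 < N.+1%:R :> R by rewrite ltr0n.
have bsum : \sum_(n < N.+1) b n ^+ 2 <= N.+1%:R.
  rewrite -[leRHS]mulr1 mulr_natl -[in leRHS](card_ord N.+1) -sumr_const.
  by apply: ler_sum => n _; rewrite -real_normK ?num_real// expr_le1.
have : 0 <= \sum_(n < N.+1) (N.+1%:R * a n - S * b n) ^+ 2.
  by apply: sumr_ge0 => n _; rewrite sqr_ge0.
have -> : \sum_(n < N.+1) (N.+1%:R * a n - S * b n) ^+ 2 =
    N.+1%:R ^+ 2 * T - 2 * N.+1%:R * S * S + S ^+ 2 * \sum_(n < N.+1) b n ^+ 2.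
  rewrite [X in _ - X + _](_ : _ = \sum_(n < N.+1)
      2 * N.+1%:R * S * (a n * b n)); last by rewrite -mulr_sumr.
  rewrite /T [_ * \sum_(n < N.+1) a n ^+ 2]mulr_sumr.
  rewrite [_ * \sum_(n < N.+1) b n ^+ 2]mulr_sumr -sumrN -!big_split/=.
  by apply: eq_bigr => n _; ring.
move=> h.
have : S ^+ 2 * \sum_(n < N.+1) b n ^+ 2 <= S ^+ 2 * N.+1%:R.
  by rewrite ler_wpM2l// sqr_ge0.
move=> h2.
rewrite -(ler_pM2l N0); lra.
Qed.

(** In mean square, v is the limit of c times averages of K shifts of v, K being
arbitrarily large. This is a form of singularity of the spectrum of v: the
coefficients c / K of the shifts have a small sum of squares. *)
Definition shift_approximable (R : realType) (v : nat -> R) (c : R) : Prop :=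
  forall eps : R, 0 < eps -> exists (K : nat) (s : nat -> nat),
    [/\ (0 < K)%N, K%:R^-1 <= eps,
        forall i k, (i < K)%N -> (k < K)%N -> s i = s k -> i = k &
        upper_mean_le (fun N => \sum_(n < N)
          (v n - c / K%:R * \sum_(i < K) v (n + s i)%N) ^+ 2) eps].

Section VanDerCorput.
Context {R : realType} (Q : nat) (z : nat -> nat -> R) (eta : R).
Hypothesis z1 : forall n j, `|z n j| <= 1.
Hypothesis eta0 : 0 <= eta.
Hypothesis corr : forall h, (0 < h)%N -> upper_mean_le
  (fun N => \sum_(n < N) \sum_(j < Q) z (n + h)%N j * z n j) eta.

Let inner_le n m : `|\sum_(j < Q) z n j * z m j| <= Q%:R.
Proof.
apply: (le_trans (ler_norm_sum _ _ _)).
rewrite -[leRHS]mulr1 mulr_natl -[in leRHS](card_ord Q) -sumr_const.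
by apply: ler_sum => j _; rewrite normrM mulr_ile1.
Qed.

(** By stationarity, translating both factors does not change the mean. *)
Let corr_shift (p p' : nat) : upper_mean_le
  (fun N => \sum_(n < N) \sum_(j < Q) z (n + p)%N j * z (n + p')%N j)
  (if p == p' then Q%:R else eta).
Proof.
case: eqP => [<-|/eqP pp'].
  apply: (@upper_mean_le_linear _ _ _ 0) => N; rewrite addr0.
  rewrite -[in leRHS](card_ord N) mulr_natr -sumr_const.
  by apply: ler_sum => n _; apply: le_trans (ler_norm _) (inner_le _ _).
wlog lt_pp : p p' pp' / (p' < p)%N => [H|].
  case: (ltngtP p' p) => [|lt|E]; [exact: H| |by rewrite E eqxx in pp'].
  apply: (@upper_mean_le_trans _ _ _ _ 0 _ (H p' p _ lt)); last by rewrite eq_sym.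
  move=> N; rewrite addr0; apply: ler_sum => n _; apply: ler_sum => j _.
  by rewrite mulrC.
set h := (p - p')%N.
have h0 : (0 < h)%N by rewrite subn_gt0.
pose g n := \sum_(j < Q) z (n + h)%N j * z n j.
apply: (@upper_mean_le_trans _ _ _ _ (2 * Q%:R * p'%:R) _ (corr h0)) => N.
have := @sum_shift_bound _ g Q%:R p' N (fun n => inner_le _ _).
move=> /(le_trans (ler_norm _)); rewrite lerBlDl; apply: le_trans.
rewrite le_eqVlt; apply/orP; left; apply/eqP; apply: eq_bigr => n _.
by apply: eq_bigr => j _; rewrite -addnA subnKC// ltnW.
Qed.

(** In the expansion of the square, the K diagonal terms contribute at most
Q / K and the others at most eta. *)
Let mean_square_shifts (K : nat) (t : nat -> nat) : (0 < K)%N ->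
  (forall i k, (i < K)%N -> (k < K)%N -> t i = t k -> i = k) ->
  upper_mean_le (fun N => \sum_(n < N) \sum_(j < Q)
      (K%:R^-1 * \sum_(i < K) z (n + t i)%N j) ^+ 2)
    (K%:R^-1 * Q%:R + eta).
Proof.
move=> K0 tinj.
have K0r : 0 < K%:R :> R by rewrite ltr0n.
pose F i k N := \sum_(n < N) \sum_(j < Q) z (n + t i)%N j * z (n + t k)%N j.
have H : upper_mean_le (fun N => K%:R^-1 ^+ 2 * \sum_(i < K) \sum_(k < K) F i k N)
   (K%:R^-1 ^+ 2 * \sum_(i < K) \sum_(k < K) (if t i == t k then Q%:R else eta)).
  apply: upper_mean_leZ; first by rewrite sqr_ge0.
  apply: (upper_mean_le_sum (u := fun i N => \sum_(k < K) F i k N)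
    (e := fun i => \sum_(k < K) (if t i == t k then Q%:R else eta))) => i iK.
  apply: (upper_mean_le_sum (u := fun k N => F i k N)
    (e := fun k => if t i == t k then Q%:R else eta)) => k kK.
  exact: corr_shift.
apply: (upper_mean_leW (e := K%:R^-1 ^+ 2 *
    \sum_(i < K) \sum_(k < K) (if t i == t k then Q%:R else eta))); last first.
  apply: (upper_mean_le_trans (A := 0) _ H) => N.
  rewrite addr0 le_eqVlt; apply/orP; left; apply/eqP; rewrite /F.
  under [in RHS]eq_bigr do rewrite exchange_big/=.
  rewrite [in RHS]exchange_big/= [RHS]mulr_sumr; apply: eq_bigr => n _.
  under [in RHS]eq_bigr do rewrite exchange_big/=.
  rewrite [in RHS]exchange_big/= [RHS]mulr_sumr; apply: eq_bigr => j _.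
  rewrite exprMn; congr (_ * _); rewrite expr2 big_distrlr/=.
  by apply: eq_bigr => i _; apply: eq_bigr => k _.
have : \sum_(i < K) \sum_(k < K) (if t i == t k then Q%:R else eta) <=
    \sum_(i < K) (Q%:R + K%:R * eta).
  apply: ler_sum => i _; rewrite (bigD1 i)//= eqxx lerD2l.
  rewrite -[in leRHS](card_ord K) mulr_natl -sumr_const [leRHS](bigD1 i)//=.
  rewrite -[leLHS]add0r; apply: lerD => //; apply: ler_sum => k ki.
  case: eqP => // /tinj E; move: ki; rewrite -(inj_eq val_inj) /= E ?eqxx//.
rewrite sumr_const card_ord => h.
have -> : K%:R^-1 * Q%:R + eta = K%:R^-1 ^+ 2 * ((Q%:R + K%:R * eta) *+ K).
  by rewrite -mulr_natr; field; rewrite gt_eqF.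
by rewrite ler_wpM2l// sqr_ge0.
Qed.

(** Write v = (v - V) + V with V the approximating average of shifts. The first
part is handled by Cauchy-Schwarz and is as small as desired; in the second
one the shifts are moved to z, and Cauchy-Schwarz against v leaves the mean
square of an average of shifts of z. *)
Lemma van_der_corput_weighted (v : nat -> R) (c : R) :
  (forall n, `|v n| <= 1) -> shift_approximable v c ->
  forall d : R, 0 < d -> exists A : R, forall N : nat,
    \sum_(j < Q) (\sum_(n < N) v n * z n j) ^+ 2
      <= N%:R * ((4 * c ^+ 2 * eta + d) * N%:R + A).
Proof.
move=> v1 vapp d d0.
(* K is chosen so that 1 / K, the error of the approximation and the slack of
   the combined bound are all at most d / D. *)
pose D := 2 * Q%:R + 4 * c ^+ 2 * Q%:R + 1.
have Q0 : 0 <= Q%:R :> R by [].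
have c0 : 0 <= c ^+ 2 by rewrite sqr_ge0.
have D0 : 0 < D by rewrite /D; nra.
have [K [s [K0 Keps sinj vle]]] := vapp _ (divr_gt0 d0 D0).
pose S := \max_(i < K) s i.
have sS i : (i < K)%N -> (s i <= S)%N.
  by move=> iK; apply: (leq_bigmax (F := fun i : 'I_K => s i) (Ordinal iK)).
pose t i := (S - s i)%N.
have tinj i k : (i < K)%N -> (k < K)%N -> t i = t k -> i = k.
  move=> iK kK; rewrite /t => E; apply: sinj => //.
  by move: (sS _ iK) (sS _ kK) E; lia.
pose V n := c / K%:R * \sum_(i < K) v (n + s i)%N.
pose Z n j := K%:R^-1 * \sum_(i < K) z (n + t i)%N j.
have Zle := mean_square_shifts K0 tinj.
have comb : upper_mean_le (fun N =>
   2 * Q%:R * \sum_(n < N) (v n - V n) ^+ 2 +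
   4 * c ^+ 2 * \sum_(n < N) \sum_(j < Q) Z n j ^+ 2)
   (2 * Q%:R * (d / D) + 4 * c ^+ 2 * (K%:R^-1 * Q%:R + eta)).
  by apply: upper_mean_leD; apply: upper_mean_leZ => //; nra.
have [A HA] := comb _ (divr_gt0 d0 D0).
have K0r : 0 < K%:R :> R by rewrite ltr0n.
(* Z uses the shifts S - s i because those of v, brought to the common shift S,
   leave z shifted by S - s i; this costs only boundary terms. *)
have move_shift N j : `|\sum_(n < N) V n * z n j -
    c * \sum_(n < N) v (n + S)%N * Z n j| <= 2 * `|c| * S%:R.
  have -> : \sum_(n < N) V n * z n j - c * \sum_(n < N) v (n + S)%N * Z n j =
     c / K%:R * \sum_(i < K) (\sum_(n < N) v (n + s i)%N * z n j
        - \sum_(n < N) v (n + t i + s i)%N * z (n + t i)%N j).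
    rewrite sumrB mulrBr; congr (_ - _).
      rewrite [in RHS]exchange_big/= [RHS]mulr_sumr; apply: eq_bigr => n _.
      by rewrite /V -mulrA mulr_suml.
    rewrite exchange_big/= -mulrA; congr (_ * _).
    rewrite mulr_sumr; apply: eq_bigr => n _.
    rewrite /Z mulrCA; congr (_ * _); rewrite mulr_sumr.
    by apply: eq_bigr => i _; rewrite -addnA /t subnK// sS.
  rewrite normrM normf_div [`|K%:R|]ger0_norm//.
  have : `|\sum_(i < K) (\sum_(n < N) v (n + s i)%N * z n j
        - \sum_(n < N) v (n + t i + s i)%N * z (n + t i)%N j)| <=
     \sum_(i < K) 2 * S%:R.
    apply: (le_trans (ler_norm_sum _ _ _)); apply: ler_sum => i _.
    rewrite distrC.
    have := @sum_shift_bound _ (fun n => v (n + s i)%N * z n j) 1 (t i) N.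
    move=> /(_ _)/le_trans -> //; last by rewrite mulr1 ler_wpM2l// ler_nat leq_subr.
    by move=> n; rewrite normrM mulr_ile1.
  rewrite sumr_const card_ord -mulr_natr => h.
  rewrite mulrAC ler_pdivrMr//.
  have := ler_wpM2l (normr_ge0 c) h; lra.
exists (A + Q%:R * 4 * (2 * `|c| * S%:R) ^+ 2); case=> [|N].
  by rewrite mul0r big1// => j _; rewrite big_ord0 expr0n.
set E := 2 * `|c| * S%:R in move_shift *.
have E0 : 0 <= E by rewrite /E !mulr_ge0.
have N0 : 1 <= N.+1%:R :> R by rewrite ler1n.
have key j : (\sum_(n < N.+1) v n * z n j) ^+ 2 <=
   N.+1%:R * (2 * \sum_(n < N.+1) (v n - V n) ^+ 2 +
     4 * c ^+ 2 * \sum_(n < N.+1) Z n j ^+ 2 + 4 * E ^+ 2).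
  have -> : \sum_(n < N.+1) v n * z n j = \sum_(n < N.+1) (v n - V n) * z n j +
      \sum_(n < N.+1) V n * z n j.
    by rewrite -big_split/=; apply: eq_bigr => n _; ring.
  have h1 := @sqr_sum_mul_le _ N.+1 (fun n => v n - V n) (fun n => z n j) (fun n => z1 n j).
  have h2 := @sqr_sum_mul_le _ N.+1 (fun n => Z n j) (fun n => v (n + S)%N) (fun n => v1 _).
  have h3 := move_shift N.+1 j.
  rewrite (eq_bigr _ (fun n _ => mulrC _ _)) in h2.
  set a := \sum_(n < N.+1) (v n - V n) * z n j in h1 *.
  set b := \sum_(n < N.+1) V n * z n j in h3 *.
  set e := \sum_(n < N.+1) v (n + S)%N * Z n j in h2 h3.
  have h4 : (b - c * e) ^+ 2 <= E ^+ 2.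
    by rewrite -real_normK ?num_real// ler_sqr// nnegrE.
  have h5 : c ^+ 2 * e ^+ 2 <= c ^+ 2 * (N.+1%:R * \sum_(n < N.+1) Z n j ^+ 2).
    by rewrite ler_wpM2l.
  have h6 : E ^+ 2 <= N.+1%:R * E ^+ 2 by rewrite ler_peMl// sqr_ge0.
  have h7 : (a + b) ^+ 2 <= 2 * a ^+ 2 + 4 * (b - c * e) ^+ 2 + 4 * (c ^+ 2 * e ^+ 2).
    have := sqr_ge0 (a - b); have := sqr_ge0 (b - 2 * (c * e)); lra.
  lra.
apply: (le_trans (ler_sum _ (fun (j : 'I_Q) _ => key j))).
rewrite -mulr_sumr; apply: ler_wpM2l; first by rewrite ler0n.
rewrite !big_split/= !sumr_const card_ord -!mulr_sumr.
rewrite -[(2 * _) *+ Q]mulr_natr -[(4 * _) *+ Q]mulr_natr.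
rewrite [X in _ + _ * X + _]exchange_big/=.
have HN := HA N.+1.
have dD : d / D * D = d by rewrite divfK// gt_eqF.
have Kd : K%:R^-1 * (4 * c ^+ 2 * Q%:R) <= d / D * (4 * c ^+ 2 * Q%:R).
  by apply: ler_wpM2r => //; exact: mulr_ge0 (mulr_ge0 _ c0) Q0.
have coef : 2 * Q%:R * (d / D) + 4 * c ^+ 2 * (K%:R^-1 * Q%:R + eta) + d / D <=
   4 * c ^+ 2 * eta + d.
  have dE : d / D * (2 * Q%:R + 4 * c ^+ 2 * Q%:R + 1) = d := dD.
  by move: Kd dE; generalize (d / D) (K%:R^-1 : R) (c ^+ 2); clear; move=> *; lra.
apply: (@le_trans _ _ ((4 * c ^+ 2 * eta + d) * N.+1%:R + A +
  Q%:R * 4 * E ^+ 2)); last by rewrite addrA.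
move: (le_trans HN (lerD (ler_wpM2r (ler0n R N.+1) coef) (lexx A))).
set X := \sum_(n < N.+1) (v n - V n) ^+ 2.
set Y := \sum_(n < N.+1) \sum_(j < Q) Z n j ^+ 2 => HXY.
apply: le_trans (lerD HXY (lexx _)); rewrite le_eqVlt; apply/orP; left; apply/eqP.
ring.
Qed.
End VanDerCorput.

(** * Correlations of the Thue-Morse sequence *)

Lemma num_ones_widen (n k : nat) :
  (\sum_(i < n + k) odd (n %/ 2 ^ i))%N = num_ones n.
Proof.
rewrite big_split_ord/= [X in (_ + X)%N]big1 ?addn0// => i _.
rewrite divn_small// (leq_trans (ltn_expl n (leqnn 2)))//.
by rewrite leq_exp2l// leq_addr.
Qed.

Lemma num_ones_double (b : bool) (n : nat) :
  num_ones (b + n.*2) = (b + num_ones n)%N.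
Proof.
rewrite -(num_ones_widen (b + n.*2) 1) addn1 big_ord_recl expn0 divn1.
rewrite oddD odd_double addbF oddb; congr (_ + _)%N.
rewrite -(num_ones_widen n (b + n)).
have -> : (n + (b + n) = b + n.*2)%N by rewrite -addnn; lia.
apply: eq_bigr => i _.
by rewrite /= /bump /= add1n expnS divnMA divn2 half_bit_double.
Qed.

(** Real values, in order to form means. The value 1 at index 0 makes the doubling
identities true from 0 on. *)
Definition tm_sign (R : realType) (n : nat) : R := (-1) ^+ num_ones n.

Section TMSign.
Context {R : realType}.
Local Notation w := (@tm_sign R).

Lemma tm_sign_double n : w n.*2 = w n.
Proof. by rewrite /tm_sign -[n.*2]/(false + n.*2)%N num_ones_double. Qed.

Lemma tm_sign_doubleS n : w n.*2.+1 = - w n.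
Proof.
by rewrite /tm_sign -[n.*2.+1]/(true + n.*2)%N num_ones_double exprS mulN1r.
Qed.

Lemma sqr_tm_sign n : w n * w n = 1.
Proof. by rewrite -expr2 sqrr_sign. Qed.

Lemma norm_tm_sign n : `|w n| <= 1.
Proof. by rewrite normr_sign. Qed.

Definition tm_corr (h N : nat) : R := \sum_(n < N) w n * w (n + h)%N.

Lemma tm_corrS h N : tm_corr h N.+1 = tm_corr h N + w N * w (N + h)%N.
Proof. by rewrite /tm_corr big_ord_recr. Qed.

Lemma norm_tm_corr_term h N : `|w N * w (N + h)%N| <= 1.
Proof. by rewrite normrM mulr_ile1// norm_tm_sign. Qed.

(** Even and odd indices contribute the same sum. *)
Lemma tm_corr_double_even h N : tm_corr h.*2 N.*2 = 2 * tm_corr h N.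
Proof.
elim: N => [|N IH]; first by rewrite /tm_corr !big_ord0 mulr0.
rewrite doubleS !tm_corrS IH addSn -doubleD !tm_sign_double !tm_sign_doubleS.
ring.
Qed.

Lemma tm_corr_double_odd h N :
  tm_corr h.*2.+1 N.*2 = - (tm_corr h N + tm_corr h.+1 N).
Proof.
elim: N => [|N IH]; first by rewrite /tm_corr !big_ord0 addr0 oppr0.
rewrite doubleS !tm_corrS IH addSn !addnS -doubleD -doubleS.
rewrite !tm_sign_double !tm_sign_doubleS; ring.
Qed.

(** The constant 1 bounds the increments of the correlation sums, which are known
along even N by the doubling identities. *)
Lemma upper_mean_le_even (u : nat -> R) (e : R) :
  (forall N, u N.+1 <= u N + 1) ->
  upper_mean_le (fun N => u N.*2) (2 * e) -> upper_mean_le u e.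
Proof.
move=> ustep ule d d0.
have d20 : 0 < 2 * d by lra.
have [A HA] := ule _ d20; exists (A + 1 + `|e + d|) => N.
rewrite -(odd_double_half N); move: (odd N) N./2 => b M; have h := HA M.
have e1 := ler_norm (- (e + d)); rewrite normrN in e1.
have e2 := normr_ge0 (e + d).
rewrite natrD -muln2 natrM muln2; case: b => /=; last by rewrite add0n; lra.
have := ustep M.*2; rewrite add1n; lra.
Qed.

(** The two bounds express that tm_corr h N / N tends to g. *)
Definition tm_mean (h : nat) (g : R) : Prop :=
  upper_mean_le (tm_corr h) g /\ upper_mean_le (fun N => - tm_corr h N) (- g).

Lemma tm_mean_even h g : tm_mean h g -> tm_mean h.*2 g.
Proof.
move=> [hl hr]; split; apply: upper_mean_le_even.
- by move=> N; rewrite tm_corrS lerD2l; apply: le_trans (ler_norm _) (norm_tm_corr_term _ _).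
- apply: (@upper_mean_le_trans _ _ (fun N => 2 * tm_corr h N) _ 0).
    by move=> N; rewrite tm_corr_double_even addr0.
  exact: upper_mean_leZ.
- move=> N; rewrite tm_corrS opprD lerD2l.
  by apply: le_trans (ler_norm _) _; rewrite normrN norm_tm_corr_term.
- apply: (@upper_mean_le_trans _ _ (fun N => 2 * - tm_corr h N) _ 0).
    by move=> N; rewrite tm_corr_double_even addr0 mulrN.
  exact: upper_mean_leZ.
Qed.

Lemma tm_mean_odd h g g' : tm_mean h g -> tm_mean h.+1 g' ->
  tm_mean h.*2.+1 (- (g + g') / 2).
Proof.
move=> [hl hr] [hl' hr']; split; apply: upper_mean_le_even.
- by move=> N; rewrite tm_corrS lerD2l; apply: le_trans (ler_norm _) (norm_tm_corr_term _ _).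
- apply: (@upper_mean_le_trans _ _ (fun N => - tm_corr h N - tm_corr h.+1 N) _ 0).
    by move=> N; rewrite tm_corr_double_odd addr0 opprD.
  by have := upper_mean_leD hr hr'; apply: upper_mean_leW; lra.
- move=> N; rewrite tm_corrS opprD lerD2l.
  by apply: le_trans (ler_norm _) _; rewrite normrN norm_tm_corr_term.
- apply: (@upper_mean_le_trans _ _ (fun N => tm_corr h N + tm_corr h.+1 N) _ 0).
    by move=> N; rewrite tm_corr_double_odd addr0 opprK.
  by have := upper_mean_leD hl hl'; apply: upper_mean_leW; lra.
Qed.

(** The doubling identity gives the relation e (2 N) = - e N for
e N = 3 tm_corr 1 N + N. Passing from N to its half thus changes the absolute
value of e by a bounded amount, so that e N grows at most like log N. *)
Lemma tm_mean1 : tm_mean 1 (- 3^-1).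
Proof.
have corr0 N : tm_corr 0 N = N%:R.
  rewrite /tm_corr -[in RHS](card_ord N) -sumr_const.
  by apply: eq_bigr => n _; rewrite addn0 sqr_tm_sign.
(* The constant 32 / d covers all N <= 8 / d, since |e N| <= 4 N; for larger N
   the gain d N / 2 in the induction step exceeds the cost 4 of an odd step. *)
have bnd (d : R) : 0 < d -> forall N, `|3 * tm_corr 1 N + N%:R| <= d * N%:R + 32 / d.
  move=> d0; elim/ltn_ind => N IH.
  have [small|big] := lerP (d * N%:R) 8; last first.
    have N0 : (0 < N)%N by case: N big {IH} => //; rewrite mulr0; lra.
    have half_lt : (N./2 < N)%N by rewrite ltn_half_double -addnn; lia.
    have := IH _ half_lt; move: big {IH half_lt N0}.
    have even_step M : 3 * tm_corr 1 M.*2 + 2 * M%:R = - (3 * tm_corr 1 M + M%:R).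
      by rewrite (tm_corr_double_odd 0) corr0; ring.
    rewrite -(odd_double_half N); move: (odd N) N./2 => b M.
    rewrite half_bit_double natrD -[M.*2]muln2 natrM muln2; case: b => /= big h.
      rewrite add1n tm_corrS.
      have := even_step M; have := norm_tm_corr_term 1 M.*2.
      move: h; rewrite !ler_norml; lra.
    rewrite add0n add0r [M%:R * 2]mulrC even_step normrN.
    apply: (le_trans h); lra.
  have h : `|tm_corr 1 N| <= N%:R.
    apply: (le_trans (ler_norm_sum _ _ _)).
    rewrite -[in leRHS](card_ord N) -sumr_const.
    by apply: ler_sum => n _; exact: norm_tm_corr_term.
  have N32 : 4 * N%:R <= 32 / d by rewrite ler_pdivlMr//; lra.
  have : 0 <= d * N%:R by rewrite mulr_ge0// ltW.
  move: h; rewrite !ler_norml; lra.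
split=> d d0; exists (32 / d) => N; have d30 : 0 < 3 * d by lra.
  have := bnd _ d30 N; have : 32 / (3 * d) <= 3 * (32 / d).
    rewrite invfM; have : 0 < d^-1 by rewrite invr_gt0. lra.
  rewrite ler_norml; lra.
have := bnd _ d30 N; have : 32 / (3 * d) <= 3 * (32 / d).
  rewrite invfM; have : 0 < d^-1 by rewrite invr_gt0. lra.
rewrite ler_norml; lra.
Qed.

Lemma tm_mean_pow2 k h g : tm_mean h g -> tm_mean (2 ^ k * h) g.
Proof.
move=> hg; elim: k => [|k IH]; first by rewrite mul1n.
by rewrite expnS -mulnA mul2n; exact: tm_mean_even.
Qed.

(** The recursion g_(m+1) = - (g_m - 1/3) / 2, which comes from
2^(m+2) - 1 = 2 (2^(m+1) - 1) + 1 and the value -1/3 at powers of 2, contracts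
to the fixed point 1/9. *)
Lemma tm_mean_pow2_pred m :
  tm_mean (2 ^ m.+1).-1 (9^-1 - 9^-1 * 4 * (- 2^-1) ^+ m).
Proof.
elim: m => [|m IH].
  by have := tm_mean1; congr tm_mean; rewrite expr0; lra.
have -> : (2 ^ m.+2).-1 = (2 ^ m.+1).-1.*2.+1.
  by rewrite (expnS _ m.+1); have := expn_gt0 2 m.+1; lia.
have := tm_mean_pow2 m.+1 tm_mean1; rewrite muln1 -{1}(@prednK (2 ^ m.+1)) ?expn_gt0//.
move=> /(tm_mean_odd IH); congr tm_mean; rewrite exprS; lra.
Qed.


Lemma tm_shift_corr (a h : nat) (g : R) : tm_mean h g ->
  upper_mean_le (fun N => \sum_(n < N) w (n + a)%N * w (n + (a + h))%N) g.
Proof.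
move=> [hl _].
apply: (upper_mean_le_trans (A := 2 * a%:R) _ hl) => N.
have := @sum_shift_bound _ (fun n => w n * w (n + h)%N) 1 a N
  (fun n => norm_tm_corr_term h n).
move=> /(le_trans (ler_norm _)); rewrite lerBlDl mulr1.
by under eq_bigr do rewrite -addnA.
Qed.

(** For i < k the difference of the shifts is 2^(K i) (2^(K (k - i)) - 1), whose
correlation is within 2^-K of 1/9. The exponents are multiples of K
in order that this error is at most 1 / K for all pairs. *)
Lemma tm_pair_corr (K i k : nat) : (0 < K)%N ->
  upper_mean_le (fun N =>
      \sum_(n < N) w (n + 2 ^ (K * i))%N * w (n + 2 ^ (K * k))%N)
    (if i == k then 1 else 9^-1 + K%:R^-1).
Proof.
move=> K0; case: eqP => [<-|/eqP ik].
  apply: (@upper_mean_le_linear _ _ _ 0) => N; rewrite addr0 mul1r.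
  rewrite -[in leRHS](card_ord N) -sumr_const.
  by apply: ler_sum => n _; rewrite sqr_tm_sign.
wlog lt_ik : i k ik / (i < k)%N => [H|].
  case: (ltngtP i k) => [|lt|E]; [exact: H| |by rewrite E eqxx in ik].
  apply: (upper_mean_le_trans (A := 0) _ (H k i _ lt)); last by rewrite eq_sym.
  by move=> N; rewrite addr0; apply: ler_sum => n _; rewrite mulrC.
have [m Em] : exists m, (K * (k - i) = m.+1)%N.
  by exists (K * (k - i)).-1; rewrite prednK// muln_gt0 K0 subn_gt0.
have Km : (K <= m.+1)%N by rewrite -Em leq_pmulr// subn_gt0.
have Ek : (2 ^ (K * k) = 2 ^ (K * i) + 2 ^ (K * i) * (2 ^ m.+1).-1)%N.
  rewrite -{1}(subnKC (ltnW lt_ik)) mulnDr expnD Em -mulnS prednK//.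
  by rewrite expn_gt0.
have Kr : 0 < K%:R :> R by rewrite ltr0n.
have pow_le : - (- 2^-1) ^+ m <= K%:R^-1 :> R.
  apply: (le_trans (ler_norm _)); rewrite normrN normrX normrN normfV.
  rewrite normr_nat exprVn lef_pV2 ?posrE ?exprn_gt0// -natrX ler_nat.
  exact: leq_trans Km (ltn_expl m (leqnn 2)).
have gle : 9^-1 - 9^-1 * 4 * (- 2^-1) ^+ m <= 9^-1 + K%:R^-1 :> R.
  have Ki : 0 < K%:R^-1 :> R by rewrite invr_gt0. lra.
apply: (upper_mean_leW gle).
under eq_fun do under eq_bigr do rewrite Ek.
exact: tm_shift_corr (tm_mean_pow2 (K * i) (tm_mean_pow2_pred m)).
Qed.

(** Expanding the square gives 1 - 2 + (9 / K^2) (K + K^2 (1/9 + 1/K)), which is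
18 / K: the constant 3 is the inverse of the mean 1/3 of the products of - w_n with
its shifts. *)
Lemma shift_approximable_tm_sign : shift_approximable w (- 3).
Proof.
move=> eps eps0.
pose K := (Num.truncn (18 / eps)).+1.
have Kr : 0 < K%:R :> R by rewrite ltr0n.
have Keps : 18 / K%:R <= eps.
  rewrite ler_pdivrMr// mulrC -ler_pdivrMr// ltW// truncnS_gt//.
exists K, (fun i => 2 ^ (K * i))%N; split => //.
- by have : 0 < K%:R^-1 :> R; rewrite ?invr_gt0//; lra.
- by move=> i k _ _ /eqP; rewrite eqn_exp2l// eqn_pmul2l// => /eqP.
pose F i k N := \sum_(n < N) w (n + 2 ^ (K * i))%N * w (n + 2 ^ (K * k))%N.
have cross : upper_mean_le (fun N => \sum_(i < K) \sum_(k < K) F i k N)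
    (\sum_(i < K) \sum_(k < K) (if i == k then 1 else 9^-1 + K%:R^-1)).
  apply: (upper_mean_le_sum (u := fun i N => \sum_(k < K) F i k N)
    (e := fun i => \sum_(k < K) (if i == k :> nat then 1 else 9^-1 + K%:R^-1)))
    => i iK.
  apply: (upper_mean_le_sum (u := fun k N => F i k N)
    (e := fun k => if i == k then 1 else 9^-1 + K%:R^-1)) => k kK.
  exact: tm_pair_corr.
have single : upper_mean_le (fun N => \sum_(i < K) tm_corr (2 ^ (K * i)) N)
    (\sum_(i < K) - 3^-1).
  apply: (upper_mean_le_sum (u := fun i N => tm_corr (2 ^ (K * i)) N)
    (e := fun _ => - 3^-1)) => i _.
  by have [h _] := tm_mean_pow2 (K * i) tm_mean1; rewrite muln1 in h.
have diag : upper_mean_le (fun N => N%:R : R) 1.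
  by apply: (@upper_mean_le_linear _ _ _ 0) => N; rewrite mul1r addr0.
have c1 : 0 <= 6 / K%:R :> R by rewrite divr_ge0.
have c2 : 0 <= 9 / K%:R ^+ 2 :> R by rewrite divr_ge0// sqr_ge0.
have := upper_mean_leD diag
  (upper_mean_leD (upper_mean_leZ c1 single) (upper_mean_leZ c2 cross)).
set e := (X in upper_mean_le _ X) => H.
have e_eps : e <= eps.
  have : \sum_(i < K) \sum_(k < K) (if i == k then 1 else 9^-1 + K%:R^-1) <=
      \sum_(i < K) (1 + K%:R * (9^-1 + K%:R^-1)) :> R.
    apply: ler_sum => i _; rewrite (bigD1 i)//= eqxx lerD2l.
    have p0 : 0 <= 9^-1 + K%:R^-1 :> R by rewrite addr_ge0 ?invr_ge0.
    move: (9^-1 + _) p0 => p p0.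
    have -> : K%:R * p = \sum_(k < K) p by rewrite sumr_const card_ord mulr_natl.
    rewrite [leRHS](bigD1 i)//=.
    rewrite -[leLHS]add0r; apply: lerD => //; apply: ler_sum => k ki.
    by rewrite [i == k]eq_sym (negbTE ki).
  rewrite /e !sumr_const card_ord -[(- 3^-1) *+ K]mulr_natr.
  rewrite -[(1 + _) *+ K]mulr_natr => /(ler_wpM2l c2) h.
  apply: le_trans Keps; rewrite -lerBrDl.
  apply: (le_trans (lerD (lexx _) h)).
  rewrite le_eqVlt; apply/orP; left; apply/eqP; field.
  by rewrite gt_eqF.
apply: (upper_mean_leW e_eps); apply: (upper_mean_le_trans (A := 0) _ H) => N.
rewrite addr0 le_eqVlt; apply/orP; left; apply/eqP.
have -> : N%:R = \sum_(n < N) w n * w n.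
  under eq_bigr do rewrite sqr_tm_sign.
  by rewrite sumr_const card_ord.
rewrite /F /tm_corr.
under [X in _ + (_ + _ * X)]eq_bigr do rewrite exchange_big/=.
rewrite [X in _ + (_ * X + _)]exchange_big/= [X in _ + (_ + _ * X)]exchange_big/=.
rewrite !mulr_sumr -!big_split/=; apply: eq_bigr => n _.
rewrite -mulr_sumr -big_distrlr/=.
set T := \sum_(i < K) _.
by field; rewrite gt_eqF.
Qed.

End TMSign.

(** * Windows on the cyclic group of order Q *)

Section Windows.
Context {R : realType} (Q q : nat).
Hypothesis Q0 : (0 < Q)%N.
Hypothesis qQ : (q <= Q)%N.

(** The indicator of the first q residues modulo Q, centred so as to have sum 0
over a period. *)
Definition window (i : nat) : R := ((i %% Q < q)%N)%:R - q%:R / Q%:R.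
Local Notation f := window.

Let Q0r : 0 < Q%:R :> R. Proof. by rewrite ltr0n. Qed.

Lemma window_periodic k i : f (k * Q + i) = f i.
Proof. by rewrite /f modnMDl. Qed.

Lemma norm_window i : `|f i| <= 1.
Proof.
have : 0 <= q%:R / Q%:R :> R by rewrite divr_ge0.
have : q%:R / Q%:R <= 1 :> R by rewrite ler_pdivrMr// mul1r ler_nat.
rewrite /f ler_norml; case: (_ < _)%N => /=; lra.
Qed.

Lemma sum_periodic_shift (g : nat -> R) (k : nat) :
  (forall i, g (Q + i)%N = g i) ->
  \sum_(j < Q) g (j + k)%N = \sum_(j < Q) g j.
Proof.
move=> gper; elim: k => [|k IH]; first by under eq_bigr do rewrite addn0.
rewrite -IH; case: Q Q0 gper => // P _ gper.
rewrite [RHS]big_ord_recl big_ord_recr/= addrC; congr (_ + _).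
  by rewrite addnS -addSn gper.
by apply: eq_bigr => j _; rewrite /bump/= add1n addSnnS.
Qed.

Lemma sum_window : \sum_(j < Q) f j = 0.
Proof.
rewrite /f sumrB sumr_const card_ord -[X in _ - X]mulr_natr divfK ?gt_eqF// -natr_sum.
apply/eqP; rewrite subr_eq0 eqr_nat -[X in _ == X](card_ord q) -sum1_card.
rewrite (big_ord_widen _ (fun=> 1%N) qQ).
apply/eqP; rewrite [RHS]big_mkcond/=; apply: eq_bigr => j _.
by rewrite modn_small//; case: (_ < _)%N.
Qed.

(** The indicator jumps only at the two ends of the window. *)
Lemma window_variation : \sum_(j < Q) `|f j.+1 - f j| <= 2.
Proof.
have -> : 2 = 1 + 1 :> R by [].
have one (p : nat) : \sum_(j < Q) (j.+1 == p)%:R <= 1 :> R.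
  rewrite -natr_sum lern1 -big_mkcond/= sum1_card.
  by apply/card_le1_eqP => i j /eqP hi /eqP hj; apply/val_inj/succn_inj; rewrite hi hj.
apply: (le_trans _ (lerD (one q) (one Q))); rewrite -big_split/=.
apply: ler_sum => j _; rewrite /f opprB addrA subrK.
have jQ := ltn_ord j; rewrite [(j %% Q)%N]modn_small//.
have [jQ'|jQ'] := ltnP j.+1 Q.
  rewrite modn_small//; case: (ltngtP j.+1 q) => h.
  - by rewrite subrr normr0 addr_ge0.
  - by rewrite subrr normr0 addr_ge0.
  - by rewrite sub0r normrN normr1 lerDl.
rewrite [(j.+1 == Q)](_ : _ = true); last by apply/eqP/anti_leq; rewrite jQ jQ'.
apply: (@le_trans _ _ 1); last by rewrite lerDr.
by case: (_ < _)%N; case: (_ < _)%N; rewrite ?subrr ?subr0 ?sub0r ?normrN ?normr0 ?normr1.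
Qed.

Definition window_corr (d : nat) : R := \sum_(j < Q) f (j + d)%N * f j.

Lemma window_corr_shift b d :
  \sum_(j < Q) f (b + d + j)%N * f (b + j)%N = window_corr d.
Proof.
rewrite /window_corr -(@sum_periodic_shift (fun i => f (i + d)%N * f i) b)/=; last first.
  by move=> i; rewrite -addnA -[Q]mul1n !window_periodic.
by apply: eq_bigr => j _; rewrite addnAC [(b + j)%N]addnC.
Qed.

(** A unit translation changes the inner product by at most the total variation of
the window, hence by a bound that does not depend on Q. *)
Lemma window_corr_step d : window_corr d.+1 <= window_corr d + 2.
Proof.
rewrite -lerBlDl -sumrB.
apply: (@le_trans _ _ (\sum_(j < Q) `|f (j + d).+1 - f (j + d)%N|)).
  apply: ler_sum => j _; rewrite addnS -mulrBl.
  apply: (le_trans (ler_norm _)); rewrite normrM.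
  by rewrite ler_piMr// norm_window.
rewrite (@sum_periodic_shift (fun i => `|f i.+1 - f i|) d); last first.
  by move=> i; rewrite -addnS -[Q]mul1n !window_periodic.
exact: window_variation.
Qed.

Lemma sum_window_corr : \sum_(d < Q) window_corr d = 0.
Proof.
rewrite exchange_big/= big1// => j _; rewrite -mulr_suml.
under eq_bigr do rewrite addnC.
rewrite sum_periodic_shift ?sum_window ?mul0r// => i.
by rewrite -[Q in f (Q + i)%N]mul1n window_periodic.
Qed.

End Windows.

(** * Window coordinates of the sequence *)

(** The finitely many exceptional N are absorbed in the additive constant. *)
Lemma cvg_upper_mean_le (R : realType) (u : nat -> R) (l : R) :
  u N / N%:R @[N --> \oo] --> l -> upper_mean_le u l.
Proof.
move=> /cvgrPdist_lt ul d d0; have [N0 _ HN0] := ul _ d0.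
exists (\sum_(n < N0.+1) (`|u n| + `|l + d| * n%:R)) => N.
have [NN0|NN0] := ltnP N N0.+1.
  rewrite (bigD1 (Ordinal NN0))//=.
  have : 0 <= \sum_(i < N0.+1 | i != Ordinal NN0) (`|u i| + `|l + d| * i%:R).
    by apply: sumr_ge0 => i _; rewrite addr_ge0// mulr_ge0.
  have := ler_norm (u N); have := ler_wpM2r (ler0n R N) (ler_norm (- (l + d))).
  rewrite normrN; lra.
have N1 : 0 < N%:R :> R by rewrite ltr0n (leq_trans _ NN0).
have := HN0 N (ltnW NN0); rewrite /= ltr_norml => /andP[h _].
have : 0 <= \sum_(n < N0.+1) (`|u n| + `|l + d| * n%:R).
  by apply: sumr_ge0 => i _; rewrite addr_ge0// mulr_ge0.
have : u N <= (l + d) * N%:R by rewrite -ler_pdivrMr//; lra.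
lra.
Qed.

Lemma unif_distributed_upper_mean (R : realType) (y : nat -> R) (c a b : R) (l r : bool) :
  unif_distributed y -> 0 <= a -> a <= b -> b <= 1 ->
  upper_mean_le (fun N => c * \sum_(1 <= n < N.+1)
    (y n \in Interval (BSide l a) (BSide r b))%:R) (c * (b - a)).
Proof.
move=> yu a0 ab b1; apply: cvg_upper_mean_le.
have h := cvgM (cvg_cst c) (yu a b l r a0 ab b1).
under eq_cvg do rewrite -natr_sum -mulrA.
exact: h.
Qed.

Section Cells.
Context {R : realType} (Q : nat).
Hypothesis Q0 : (0 < Q)%N.

Definition cell (y : R) : nat := Num.truncn (Q%:R * y).

Let Q0r : 0 < Q%:R :> R. Proof. by rewrite ltr0n. Qed.

Lemma cell_itv y : 0 <= y -> (cell y)%:R <= Q%:R * y < (cell y).+1%:R.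
Proof. by move=> y0; rewrite truncn_itv// mulr_ge0. Qed.

Lemma frac_part_itv (y : R) : 0 <= frac_part y < 1.
Proof. by have := floor_itv y; rewrite /frac_part intrD; lra. Qed.

Lemma cell_frac_part_lt y : (cell (frac_part y) < Q)%N.
Proof.
have /andP[f0 f1] := frac_part_itv y.
by rewrite truncn_lt_nat ?mulr_ge0// gtr_pMr.
Qed.

Lemma mem_cell y d : 0 <= y ->
  (y \in Interval (BSide true (d%:R / Q%:R)) (BSide true (d.+1%:R / Q%:R))) =
  (cell y == d).
Proof.
move=> y0; rewrite truncn_eq ?mulr_ge0// in_itv/= ler_pdivrMr// ltr_pdivlMr//.
by rewrite [y * _]mulrC.
Qed.

(** Modulo Q, taking cells commutes with subtraction up to a carry e of 0 or 1. The
multiple of Q is added on the left because x' - x lies in [-1, 1], where the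
floor may be -1, 0 or 1. *)
Lemma cell_sub (y y' : R) : 0 <= y <= 1 -> 0 <= y' <= 1 ->
  exists (k : nat) (e : bool),
    (k * Q + cell y' = Q + cell y + cell (frac_part (y' - y)) + e)%N.
Proof.
move=> /andP[y0 y1] /andP[y'0 y'1].
have /andP[f0 f1] := frac_part_itv (y' - y).
have h1 := cell_itv y0; have h2 := cell_itv y'0; have h3 := cell_itv f0.
have k1 : (Num.floor (y' - y) <= 1)%R.
  by rewrite -ltzD1 floor_lt_int/= intrD; lra.
move: h1 h2 h3.
set a := cell y; set a' := cell y'; set d := cell _.
rewrite /frac_part; move: (Num.floor _) k1 => k k1 h1 h2 h3.
(* i is an integer strictly between -1 and 2, hence the carry. *)
have [i Ei] : exists i : int, i = a'%:Z - a%:Z - d%:Z - Q%:Z * k by eexists.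
have ER : i%:~R = a'%:R - a%:R - d%:R - Q%:R * k%:~R :> R.
  by rewrite Ei !intrD !mulrNz intrM -!pmulrn.
rewrite -!natr1 in h1 h2 h3.
have il : (-1 < i)%R by rewrite -(ltr_int R) ER mulrNz; lra.
have iu : (i < 2)%R by rewrite -(ltr_int R) ER; lra.
have [p Ek] : exists p : nat, k = 1 - p%:Z.
  by exists `|1 - k|%N; rewrite gez0_abs ?subr_ge0// opprB addrCA subrr addr0.
have i01 : i = (i == 1)%:Z by move: il iu; clear; case: eqP => [->|]//; lia.
exists p, (i == 1); apply/eqP; rewrite -eqz_nat !PoszD PoszM -i01 Ei Ek.
by apply/eqP; ring.
Qed.

End Cells.

Section Features.
Context {R : realType} (x : nat -> R) (Q q m : nat).
Hypothesis Q0 : (0 < Q)%N.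
Hypothesis qQ : (q <= Q)%N.
Hypothesis x01 : forall n : nat, (0 < n)%N -> 0 <= x n <= 1.
Hypothesis xdiff : forall h : nat, (0 < h)%N ->
  unif_distributed (fun n : nat => frac_part (x (n + h)%N - x n)).

(** The offset m translates all windows together; it serves to place a prescribed
interval in the first ones. *)
Definition feature (n j : nat) : R := window Q q (cell Q (x n) + m + j).

Lemma feature_corr h n : (0 < n)%N ->
  \sum_(j < Q) feature (n + h) j * feature n j <=
  window_corr Q q (cell Q (frac_part (x (n + h)%N - x n))) + 2 :> R.
Proof.
move=> n0; set d := cell Q (frac_part _).
have [k [e Ee]] := cell_sub Q (x01 n0) (x01 (leq_trans n0 (leq_addr h n))).
have -> : \sum_(j < Q) feature (n + h) j * feature n j =
    window_corr Q q (d + e) :> R.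
  rewrite -(window_corr_shift q Q0 (cell Q (x n) + m)); apply: eq_bigr => j _.
  congr (_ * _); rewrite /feature -(window_periodic Q q k).
  rewrite -[RHS](window_periodic Q q 1); congr window; rewrite -/d in Ee; lia.
case: e {Ee} => /=; first by rewrite addn1 window_corr_step.
by rewrite addn0 lerDl.
Qed.

(** Uniform distribution of the differences makes all their cells equally
frequent, and the window correlations sum to 0 over the cells. What remains is the
bound 2 for the carry. *)
Lemma upper_mean_feature_corr h : (0 < h)%N ->
  upper_mean_le (fun N => \sum_(n < N) \sum_(j < Q) feature (n + h) j * feature n j)
    (2 : R).
Proof.
move=> h0.
pose g n : R := \sum_(j < Q) feature (n + h) j * feature n j.
have gQ n : `|g n| <= Q%:R.
  apply: (le_trans (ler_norm_sum _ _ _)).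
  have -> : Q%:R = \sum_(j < Q) 1 :> R by rewrite sumr_const card_ord.
  by apply: ler_sum => j _; rewrite normrM mulr_ile1// norm_window.
pose y n := frac_part (x (n + h)%N - x n).
have y0 n : 0 <= y n by case/andP: (frac_part_itv (x (n + h)%N - x n)).
pose I d : interval R := Interval (BSide true (d%:R / Q%:R)) (BSide true (d.+1%:R / Q%:R)).
pose count d N : R := \sum_(1 <= n < N.+1) (y n \in I d)%:R.
have Q0r : 0 < Q%:R :> R by rewrite ltr0n.
have H : upper_mean_le (fun N => \sum_(d < Q) window_corr Q q d * count d N)
    (\sum_(d < Q) window_corr Q q d * (d.+1%:R / Q%:R - d%:R / Q%:R)).
  apply: (upper_mean_le_sum (u := fun d N => window_corr Q q d * count d N)
   (e := fun d => window_corr Q q d * (d.+1%:R / Q%:R - d%:R / Q%:R))) => d dQ.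
  apply: unif_distributed_upper_mean; first exact: xdiff.
  - by rewrite divr_ge0.
  - by rewrite ler_pM2r ?invr_gt0// ler_nat.
  - by rewrite ler_pdivrMr// mul1r ler_nat.
have E0 : \sum_(d < Q) window_corr Q q d * (d.+1%:R / Q%:R - d%:R / Q%:R) = 0 :> R.
  under eq_bigr do rewrite -mulrBl -natr1 addrAC subrr add0r mul1r.
  by rewrite -mulr_suml sum_window_corr// mul0r.
rewrite E0 in H.
have two : upper_mean_le (fun N => 2 * N%:R : R) 2.
  by apply: (@upper_mean_le_linear _ _ _ 0) => N; rewrite addr0.
have := upper_mean_leD H two; rewrite add0r.
apply: (upper_mean_le_trans (A := Q%:R + Q%:R)) => N.
have -> : \sum_(n < N) \sum_(j < Q) feature (n + h) j * feature n j =
   \sum_(1 <= n < N.+1) g n + g 0%N - g N.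
  have : \sum_(0 <= n < N.+1) g n = \sum_(n < N) g n + g N.
    by rewrite big_mkord big_ord_recr.
  by rewrite big_ltn// => E; rewrite [_ + g 0%N]addrC E addrK.
have := gQ 0%N; have := gQ N; rewrite !ler_norml => /andP[b1 _] /andP[_ b2].
have : \sum_(1 <= n < N.+1) g n <=
    \sum_(d < Q) window_corr Q q d * count d N + 2 * N%:R; last by lra.
have -> : 2 * N%:R = \sum_(1 <= n < N.+1) 2 :> R.
  by rewrite sumr_const_nat subSS subn0 mulr_natr.
rewrite /count; under [X in _ <= X + _]eq_bigr do rewrite mulr_sumr.
rewrite [X in _ <= X + _]exchange_big/= -big_split/= big_nat_cond [leRHS]big_nat_cond.
apply: ler_sum => n /andP[/andP[n0 _] _].
apply: (le_trans (feature_corr h n0)); rewrite lerD2r.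
rewrite (bigD1 (Ordinal (cell_frac_part_lt Q0 (x (n + h)%N - x n))))//=.
rewrite mem_cell// eqxx mulr1 big1 ?addr0// => d dc.
rewrite mem_cell//; case: eqP => [E|]; last by rewrite mulr0.
by case/eqP: dc; apply/val_inj; rewrite /= -E.
Qed.

End Features.

(** * The upper bound along the Thue-Morse subsequence *)

Lemma shift_approximable_one (R : realType) :
  shift_approximable (fun=> 1 : R) 1.
Proof.
move=> eps eps0; pose K := (Num.truncn eps^-1).+1.
have Kr : 0 < K%:R :> R by rewrite ltr0n.
exists K, id; split => //.
  by rewrite invf_ple ?posrE// ltW// truncnS_gt.
apply: (@upper_mean_le_linear _ _ _ 0) => N.
rewrite addr0 big1 ?mulr_ge0// ?ltW// => n _.
by rewrite sumr_const card_ord mul1r mulVf ?gt_eqF// subrr expr0n.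
Qed.

Definition tm_indicator (R : realType) (n : nat) : R := (thue_morse n == 1)%:R.

Lemma tm_indicatorE (R : realType) n : tm_indicator R n = (1 + tm_sign R n) / 2.
Proof.
rewrite /tm_indicator /thue_morse /tm_sign -signr_odd -[X in 1 + X]signr_odd.
by case: (odd _); rewrite ?expr1 ?expr0 ?subrr ?mul0r// divff.
Qed.

(** Over each pair 2 n, 2 n + 1 the signs cancel; the term 1 is for a last index
without partner. *)
Lemma sum_tm_indicator_ge (R : realType) N :
  N%:R <= 2 * \sum_(n < N) tm_indicator R n + 1.
Proof.
have even_sum M : \sum_(n < M.*2) tm_sign R n = 0.
  elim: M => [|M IH]; first by rewrite big_ord0.
  by rewrite doubleS !big_ord_recr/= IH tm_sign_double tm_sign_doubleS add0r subrr.
have : - 1 <= \sum_(n < N) tm_sign R n.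
  rewrite -(odd_double_half N); case: (odd N) => /=.
    rewrite add1n big_ord_recr/= even_sum add0r.
    by have := @norm_tm_sign R N./2.*2; rewrite ler_norml => /andP[].
  by rewrite add0n even_sum; lra.
move=> signs; under eq_bigr do rewrite tm_indicatorE.
by rewrite -mulr_suml big_split/= sumr_const card_ord; lra.
Qed.

Section UpperBound.
Context {R : realType} (x : nat -> R).
Hypothesis x01 : forall n : nat, (0 < n)%N -> 0 <= x n <= 1.
Hypothesis xdiff : forall h : nat, (0 < h)%N ->
  unif_distributed (fun n : nat => frac_part (x (n + h)%N - x n)).

(** The indicator of w_n = 1 is the mean of the sequences 1 and w, which are
approximable with c = 1 and c = -3. With eta = 2 the two bounds are 8 and 72,
up to 1 each, and 41 is half of 9 + 73. *)
Lemma tm_feature_square_sum (Q q m : nat) : (0 < Q)%N -> (q <= Q)%N ->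
  exists A : R, forall N : nat,
    \sum_(j < Q) (\sum_(n < N) tm_indicator R n * feature x Q q m n j) ^+ 2
      <= N%:R * (41 * N%:R + A).
Proof.
move=> Q0 qQ.
have z1 n j : `|feature x Q q m n j| <= 1 by exact: norm_window.
have corr h : (0 < h)%N -> upper_mean_le (fun N => \sum_(n < N) \sum_(j < Q)
    feature x Q q m (n + h) j * feature x Q q m n j) 2.
  exact: upper_mean_feature_corr.
have one1 (n : nat) : `|1 : R| <= 1 by rewrite normr1.
have [A1 H1] := van_der_corput_weighted z1 (ler0n _ 2) corr one1
   (@shift_approximable_one R) (ltr01).
have [A2 H2] := van_der_corput_weighted z1 (ler0n _ 2) corr
   (@norm_tm_sign R) (@shift_approximable_tm_sign R) (ltr01).
clear one1; exists ((A1 + A2) / 2) => N.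
have h1 := H1 N; have h2 := H2 N.
apply: (@le_trans _ _ ((\sum_(j < Q) (\sum_(n < N) 1 * feature x Q q m n j) ^+ 2
  + \sum_(j < Q) (\sum_(n < N) tm_sign R n * feature x Q q m n j) ^+ 2) / 2)).
  rewrite -big_split/= mulr_suml; apply: ler_sum => j _.
  have -> : \sum_(n < N) tm_indicator R n * feature x Q q m n j =
      (\sum_(n < N) 1 * feature x Q q m n j +
       \sum_(n < N) tm_sign R n * feature x Q q m n j) / 2.
    rewrite -big_split/= mulr_suml; apply: eq_bigr => n _.
    by rewrite tm_indicatorE; ring.
  set a := \sum_(n < N) 1 * _; set b := \sum_(n < N) tm_sign R n * _.
  by have := sqr_ge0 (a - b); lra.
rewrite ler_pdivrMr//; lra.
Qed.

(** For x n in [a, b], the cell of x n, offset by Q - cell Q a, falls among the first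
cell Q b - cell Q a + 1 residues, and after any of the r translations it is
still in the window. One of these r windows has an excess of at most eps N,
since otherwise the sum of squares would be at least r eps^2 N^2. *)
Lemma tm_interval_count (a b eps : R) (r Q : nat) :
  0 <= a -> a <= b -> b <= 1 -> 0 < eps -> 41 < r%:R * eps ^+ 2 ->
  (0 < r)%N -> (r <= Q)%N -> let q := minn Q (cell Q b - cell Q a + r) in
  exists A : R, forall N : nat,
    \sum_(n < N) tm_indicator R n * ((0 < n)%N && (a <= x n <= b))%:R <=
    eps * N%:R + q%:R / Q%:R * \sum_(n < N) tm_indicator R n + A.
Proof.
move=> a0 ab b1 eps0 r41 r0 rQ q.
have Q0 : (0 < Q)%N by exact: leq_trans rQ.
have Q0r : 0 < Q%:R :> R by rewrite ltr0n.
have qQ : (q <= Q)%N by exact: geq_minl.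
pose m := (Q - cell Q a)%N.
have aQ : (cell Q a <= Q)%N.
  by rewrite truncn_le_nat -natr1; have := ler_piMr (ltW Q0r) (le_trans ab b1); lra.
have [A HA] := tm_feature_square_sum m Q0 qQ.
have delta0 : 0 < r%:R * eps ^+ 2 - 41 by lra.
set delta := r%:R * eps ^+ 2 - 41 in delta0.
have p0 n : 0 <= tm_indicator R n by [].
have p1 n : tm_indicator R n <= 1 by by rewrite /tm_indicator lern1 leq_b1.
exists (`|A| / delta) => N.
pose S j := \sum_(n < N) tm_indicator R n * feature x Q q m n j.
have sum0 : 0 <= \sum_(n < N) tm_indicator R n by exact: sumr_ge0.
have Ad0 : 0 <= `|A| / delta by rewrite divr_ge0// ltW.
have qQ0 : 0 <= q%:R / Q%:R :> R by rewrite divr_ge0.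
(* Here N is so small that the additive constant alone suffices. *)
have [small|large] := lerP N%:R (`|A| / delta).
  apply: (le_trans _ (le_trans small _)); last first.
    by rewrite lerDr addr_ge0// mulr_ge0// ltW.
  rewrite -[in leRHS](card_ord N) -sumr_const; apply: ler_sum => n _.
  by rewrite mulr_ile1//; case: (_ && _).
have [j Sj] : exists j : 'I_r, S j <= eps * N%:R.
  apply/existsP; apply: contraT => /existsPn noj.
  have N0 : 0 < N%:R :> R by exact: le_lt_trans large.
  have big : r%:R * (eps * N%:R) ^+ 2 <= \sum_(j < Q) S j ^+ 2.
    apply: (@le_trans _ _ (\sum_(j < r) S j ^+ 2)).
      rewrite mulr_natl -[in leLHS](card_ord r) -sumr_const; apply: ler_sum => j _.
      have := noj j; rewrite -ltNge => /ltW.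
      have e0 : 0 <= eps * N%:R by rewrite mulr_ge0// ltW.
      by move=> h; rewrite ler_sqr ?nnegrE//; exact: le_trans h.
    rewrite (big_ord_widen _ (fun j => S j ^+ 2) rQ).
    rewrite [leRHS](bigID (fun j : 'I_Q => (j < r)%N))/= lerDl.
    by apply: sumr_ge0 => i _; exact: sqr_ge0.
  have := le_trans big (HA N).
  have -> : r%:R * (eps * N%:R) ^+ 2 = N%:R * ((delta + 41) * N%:R).
    by rewrite /delta; ring.
  rewrite ler_pM2l// mulrDl addrC lerD2l => h.
  move: large; rewrite ltr_pdivrMr// mulrC => h'.
  by have := ler_norm A; lra.
apply: (@le_trans _ _ (S j + q%:R / Q%:R * \sum_(n < N) tm_indicator R n)); last lra.
rewrite mulr_sumr /S -big_split/=; apply: ler_sum => n _.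
rewrite [q%:R / _ * _]mulrC -mulrDr; apply: ler_wpM2l => //.
rewrite /feature /window subrK.
case: andP => [[n0 /andP[ax xb]]|_]; last by rewrite ler_nat.
rewrite ler_nat lt0b leq_min ltn_pmod//=.
have cax : (cell Q a <= cell Q (x n))%N by apply: le_truncn; rewrite ler_pM2l.
have cxb : (cell Q (x n) <= cell Q b)%N by apply: le_truncn; rewrite ler_pM2l.
move: cax cxb aQ (ltn_ord j); rewrite /m.
move: (cell Q a) (cell Q (x n)) (cell Q b) => ca cx cb; clear => cax cxb aQ jr.
have -> : (cx + (Q - ca) + j = 1 * Q + (cx - ca + j))%N by lia.
by rewrite modnMDl (leq_ltn_trans (leq_mod _ _))//; lia.
Qed.

(** The terms nk 1, ..., nk (M+1) are the n >= 1 with w_n = 1 up to nk (M+1); the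
factor (0 < n) removes n = 0, where the indicator is 1 as well. *)
Lemma sum_enumeration (nk : nat -> nat) (g : nat -> R) (M : nat) :
  increasing_enumeration nk (fun n : nat => thue_morse n = 1) ->
  \sum_(1 <= k < M.+2) g (nk k) =
  \sum_(n < (nk M.+1).+1) tm_indicator R n * ((0 < n)%N%:R * g n).
Proof.
move=> [nk_incr nk_range].
have nk_leP k l : (0 < k)%N -> (0 < l)%N -> (nk k <= nk l)%N = (k <= l)%N.
  move=> k0 l0; have [lk|kl] := ltnP l k.
    by apply/negbTE; rewrite -ltnNge nk_incr.
  move: kl; rewrite leq_eqVlt => /orP[/eqP->|kl]; first exact: leqnn.
  by apply: ltnW; exact: nk_incr.
have perm : perm_eq [seq nk k | k <- index_iota 1 M.+2]
   [seq n <- index_iota 1 (nk M.+1).+1 | thue_morse n == 1].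
  apply: uniq_perm.
  - rewrite map_inj_in_uniq ?iota_uniq// => k l.
    rewrite !mem_index_iota => /andP[k0 _] /andP[l0 _] E.
    by apply/eqP; rewrite eqn_leq -(nk_leP k l)// -(nk_leP l k)// E leqnn.
  - by rewrite filter_uniq// iota_uniq.
  move=> n; rewrite mem_filter mem_index_iota ltnS; apply/mapP/idP.
    move=> [k]; rewrite mem_index_iota => /andP[k0 kM] ->.
    have [|n0 ->] := (nk_range (nk k)).2; first by exists k.
    by rewrite n0 nk_leP// eqxx.
  move=> /and3P[/eqP nP n0 nM]; have [k [k0 Ek]] := (nk_range n).1 (conj n0 nP).
  by exists k; rewrite // mem_index_iota k0 ltnS -nk_leP// Ek.
rewrite -(big_map nk xpredT g) (perm_big _ perm)/= big_filter.
rewrite -(big_mkord xpredT (fun n => tm_indicator R n * ((0 < n)%N%:R * g n))).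
rewrite [RHS]big_ltn// mul0r mulr0 add0r big_mkcond/=.
apply: eq_big_nat => n /andP[n0 _]; rewrite n0 mul1r /tm_indicator.
by case: eqP; rewrite ?mul1r ?mul0r.
Qed.

(** Up to N = nk M, the count M of the n with w_n = 1 is at least about N / 2, so an
error eps N is at most about 2 eps M. With Q large compared to r, the window
has relative length at most b - a + eps. *)
Lemma upper_mean_tm_interval (nk : nat -> nat) (a b : R) :
  increasing_enumeration nk (fun n : nat => thue_morse n = 1) ->
  0 <= a -> a <= b -> b <= 1 ->
  upper_mean_le (fun M => \sum_(1 <= k < M.+1) (a <= x (nk k) <= b)%R%:R) (b - a).
Proof.
move=> hnk a0 ab b1 d d0.
pose eps := d / 3; have eps0 : 0 < eps by rewrite /eps; lra.
have [r r0 r41] : exists2 r : nat, (0 < r)%N & 41 < r%:R * eps ^+ 2.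
  exists (Num.truncn (41 / eps ^+ 2)).+1 => //.
  by rewrite -ltr_pdivrMr ?exprn_gt0// truncnS_gt.
have [Q rQ Qeps] : exists2 Q : nat, (r <= Q)%N & r%:R + 1 <= eps * Q%:R.
  exists ((Num.truncn ((r%:R + 1) / eps)).+1 + r)%N; first exact: leq_addl.
  rewrite mulrC -ler_pdivrMr//; apply: (le_trans (ltW (truncnS_gt _))).
  by rewrite ler_nat leq_addr.
have Q0r : 0 < Q%:R :> R by rewrite ltr0n (leq_trans r0).
have [A HA] := tm_interval_count a0 ab b1 eps0 r41 r0 rQ.
set q := minn Q _ in HA.
have qle : q%:R / Q%:R <= b - a + eps.
  rewrite ler_pdivrMr//.
  have /andP[ha1 ha2] := cell_itv Q a0.
  have /andP[hb1 hb2] := cell_itv Q (le_trans a0 ab).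
  have cab : (cell Q a <= cell Q b)%N by apply: le_truncn; rewrite ler_pM2l.
  apply: (@le_trans _ _ (cell Q b - cell Q a + r)%N%:R).
    by rewrite ler_nat geq_minr.
  by rewrite natrD natrB//; rewrite -natr1 in ha2; lra.
have qle1 : q%:R / Q%:R <= 1 :> R by rewrite ler_pdivrMr// mul1r ler_nat geq_minl.
exists (1 + 3 * eps + `|A|); case=> [|M].
  by rewrite big_geq// mulr0 add0r !addr_ge0// mulr_ge0// ltW.
have := HA (nk M.+1).+1; have := sum_tm_indicator_ge R (nk M.+1).+1.
have -> : \sum_(n < (nk M.+1).+1) tm_indicator R n = M.+1%:R + 1.
  have := sum_enumeration (fun=> 1) M hnk.
  rewrite sumr_const_nat subSS subn0 => ->.
  rewrite !big_ord_recl/= mul0r mulr0 add0r [RHS]addrC; congr (_ + _).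
    by rewrite /tm_indicator /thue_morse /num_ones big_ord0.
  by apply: eq_bigr => n _; rewrite !mulr1.
rewrite (sum_enumeration (fun n => (a <= x n <= b)%R%:R) M hnk) => Nle.
under eq_bigr do rewrite -mulnb natrM.
move=> /le_trans; apply.
have e1 := ler_wpM2l (ltW eps0) Nle.
have e2 := ler_wpM2r (ler0n R M.+1) qle.
have A1 := ler_norm A.
rewrite (_ : d = 3 * eps); last by rewrite /eps; field.
lra.
Qed.

End UpperBound.

Lemma cvg_of_upper_means (R : realType) (u : nat -> R) (l : R) :
  upper_mean_le u l -> upper_mean_le (fun N => - u N) (- l) ->
  u N / N%:R @[N --> \oo] --> l.
Proof.
move=> ul lu; apply/cvgrPdist_le => d d0.
have d20 : 0 < d / 2 by lra.
have [A HA] := ul _ d20; have [B HB] := lu _ d20.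
exists (Num.truncn ((`|A| + `|B|) / (d / 2))).+1 => // N /= HN.
have N0 : 0 < N%:R :> R by rewrite ltr0n (leq_trans _ HN).
have : (`|A| + `|B|) / (d / 2) < N%:R.
  by apply: (lt_le_trans (truncnS_gt _)); rewrite ler_nat.
rewrite ltr_pdivrMr// => big.
have [a1 b1] := (ler_norm A, ler_norm B).
have [a2 b2] := (normr_ge0 A, normr_ge0 B).
have hA := HA N; have hB := HB N.
rewrite ler_distl; apply/andP; split.
  by rewrite lerBlDr ler_pdivrMr//; lra.
by rewrite -lerBlDr ler_pdivlMr//; lra.
Qed.

(** * Uniform distribution *)

Unset Implicit Arguments.

Theorem mainTheorem5 (R : realType) (x : nat -> R) (nk : nat -> nat)
    (hx : forall n : nat, (0 < n)%N -> 0 <= x n <= 1)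
    (hdiff : forall h : nat, (0 < h)%N ->
       unif_distributed (fun n : nat => frac_part (x (n + h)%N - x n)))
    (hnk : increasing_enumeration nk (fun n : nat => thue_morse n = 1)) :
  unif_distributed (fun k : nat => x (nk k)).
Proof.
have up a b : 0 <= a -> a <= b -> b <= 1 -> upper_mean_le
    (fun M => \sum_(1 <= k < M.+1) (a <= x (nk k) <= b)%R%:R) (b - a).
  exact: upper_mean_tm_interval.
move=> a b l r a0 ab b1.
have b0 := le_trans a0 ab; have a1 := le_trans ab b1.
have memI y : y \in Interval (BSide l a) (BSide r b) -> a <= y <= b.
  rewrite in_itv/= => /andP[h1 h2]; apply/andP; split.
    by move: h1; case: (l) => //= /ltW.
  by move: h2; case: (r) => //= /ltW.
have cover y : 0 <= y <= 1 -> [|| y \in Interval (BSide l a) (BSide r b),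
    0 <= y <= a | b <= y <= 1].
  move=> /andP[-> ->]; rewrite in_itv/= !andbT.
  have [ya|ya] := lerP y a; first by rewrite orbT.
  have [by_|yb] := lerP b y; first by rewrite !orbT.
  by rewrite !lteifS.
apply: cvg_of_upper_means.
  apply: (upper_mean_le_trans (A := 0) _ (up a b a0 ab b1)) => M.
  rewrite addr0 natr_sum; apply: ler_sum => k _; rewrite ler_nat.
  by case: (boolP (_ \in _)) => // /memI ->.
(* The complement of the interval is covered by [0, a] and [b, 1]. *)
have all1 : upper_mean_le (fun M => - M%:R : R) (- 1).
  by apply: (@upper_mean_le_linear _ _ _ 0) => M; rewrite addr0 mulN1r.
have := upper_mean_leD all1 (upper_mean_leD (up 0 a (lexx _) a0 a1) (up b 1 b0 b1 (lexx _))).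
have -> : - 1 + (a - 0 + (1 - b)) = - (b - a) by ring.
apply: (upper_mean_le_trans (A := 0)) => M; rewrite addr0 lerNl opprD opprK natr_sum.
have -> : M%:R = \sum_(1 <= k < M.+1) 1 :> R by rewrite sumr_const_nat subSS subn0.
rewrite -big_split/= -sumrB [leLHS]big_nat_cond [leRHS]big_nat_cond.
apply: ler_sum => k /andP[/andP[k0 _] _].
have nk0 : (0 < nk k)%N by have [] := (hnk.2 (nk k)).2 (ex_intro _ k (conj k0 erefl)).
rewrite lerBlDr -!natrD ler1n.
by case/or3P: (cover _ (hx _ nk0)) => ->; rewrite ?addn_gt0 ?orbT.
Qed.
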